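(* For any prime power $q$, and any $b,c\in\mathbb{F}_{q^2}$, the polynomial $f(X):=X^{q+2}+bX^q+cX$ permutes $\mathbb{F}_{q^2}$ if and only if one of the following holds: (1) $q\not\equiv 1\pmod 3$, $b=0$, and $c^{q-1}$ is a root of $X^3-X^2+X$; (2) $q=2$, $b\ne 0$, and $c=1$. *)

(* Defs.v *)
From HB Require Import structures.
From mathcomp Require Import all_boot all_order all_algebra all_field.

Set Implicit Arguments.
Unset Strict Implicit.
Unset Printing Implicit Defensive.

Definition prime_power (q : nat) : Prop :=
  exists p k : nat, prime p /\ (0 < k)%N /\ q = (p ^ k)%N.

(* Main.v *)
(**
Write [x'] for [x ^+ q], so that the map is [f x = x^2 x' + b x' + c x].

If [f] is injective then the sum of [f(x)^i f(x)'^j] over [F] vanishes whenever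
[i + j < 2(q - 1)], because the sum of [x^u x'^v] is zero as soon as
[u + v < 2(q - 1)].  Choosing [3(i + j)] equal to or slightly above [2(q - 1)],
only a few terms of the binomial expansion survive.  For [q = 3k + 1], [i = j = k]
gives [-1 = 0].  For [q = 3r], [(i, j) = (r + 1, r - 1)] gives [b = 0].  For
[q = 3s - 1 > 2], [(s, s)] gives [c^2 + c'^2 = c c' + b b'], and in odd
characteristic [(s + 1, s - 1)] gives [b (c - 2c') = 0], so that [b = 0].

If [b = 0], then [f] is injective if and only if the cubic
[n (n + c) (n + c')], which maps the norm of [x] to the norm of [f x], is injective
on the subfield of order [q].

In characteristic 2 with [b <> 0] one may scale to [b = 1].  Then [f (x + d) = f x]
with [d = 1 / e], [x = y / e] reads [y^2 + y' = 1 + e^2 + c e e'].  In coordinates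
over the subfield with respect to the basis [w, w^2], [w] a primitive cube root of
unity, this splits into two Artin-Schreier equations, and they have an explicit
common solution as soon as [q > 2].
*)

Require Import Defs.
From HB Require Import structures.
From mathcomp Require Import all_boot all_order all_algebra all_field.
From mathcomp Require Import ring zify.
Import GRing.Theory.
Local Open Scope ring_scope.

(** * Counting by fibres and power sums over a finite field *)

Lemma leq_card_fibers (aT rT : finType) (h : aT -> rT) (A : {set aT}) (m : nat) :
  (forall y, #|[set x in A | h x == y]| <= m)%N -> (#|A| <= m * #|h @: A|)%N.
Proof.
move=> hm; rewrite -sum1_card (partition_big_imset h) /= mulnC -sum_nat_const.
apply: leq_sum => y _; apply: leq_trans (hm y).
by rewrite -sum1_card; apply/eq_leq/eq_bigl => x; rewrite inE.
Qed.

Lemma card_roots_leq (F : finFieldType) (P : {poly F}) (A : {set F}) (m : nat) :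
  P != 0 -> (size P <= m.+1)%N -> {in A, forall x, root P x} -> (#|A| <= m)%N.
Proof.
move=> P0 sP rA; rewrite cardE -ltnS; apply: leq_trans sP.
apply: max_poly_roots => //; last exact: enum_uniq.
by apply/allP => x; rewrite mem_enum; apply: rA.
Qed.

(** ['X^n - 1] has at most [n] roots, fewer than there are nonzero elements. *)
Lemma exists_expf_neq1 (F : finFieldType) (n : nat) :
  (0 < n < #|F|.-1)%N -> exists2 a : F, a != 0 & a ^+ n != 1.
Proof.
move=> /andP[n0 nF]; apply/exists_inP; apply: contraLR nF.
rewrite negb_exists_in -leqNgt => /forall_inP h.
rewrite -(cardsT F) -[X in (X.-1 <= _)%N]/(#|[set: F]|) (cardsD1 0) inE add1n /=.
apply: (@card_roots_leq F ('X^n - 1)); first by rewrite -size_poly_eq0 size_XnsubC.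
  by rewrite size_XnsubC.
move=> x; rewrite !inE andbT => /h; rewrite negbK => /eqP xn.
by rewrite /root !hornerE xn subrr.
Qed.

(** Replacing [x] by [a * x] multiplies the sum by [a ^+ n], which differs from [1] for a suitable
    [a]. *)
Lemma sum_expf_eq0 (F : finFieldType) (n : nat) :
  (0 < n)%N -> ~~ (#|F|.-1 %| n)%N -> \sum_(x : F) x ^+ n = 0.
Proof.
move=> n0 dn; have F1 : (1 < #|F|)%N := finNzRing_gt1 F.
have [] := @exists_expf_neq1 F (n %% #|F|.-1).
  by rewrite lt0n ltn_pmod ?andbT // -subn1 subn_gt0.
move=> a a0; have aF : a ^+ #|F|.-1 = 1.
  by apply: (mulfI a0); rewrite -exprS prednK ?(ltnW F1) // expf_card mulr1.
have -> : a ^+ (n %% #|F|.-1) = a ^+ n.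
  by rewrite [in RHS](divn_eq n #|F|.-1) exprD mulnC exprM aF expr1n mul1r.
move=> an; set S := \sum_x _.
have SE : S = a ^+ n * S.
  rewrite {1}/S (reindex_inj (mulfI a0)) /= mulr_sumr.
  by apply: eq_bigr => x _; rewrite exprMn.
have /eqP : (1 - a ^+ n) * S = 0 by rewrite mulrBl mul1r -SE subrr.
by rewrite mulf_eq0 subr_eq0 eq_sym (negPf an) => /eqP.
Qed.

(** The translation by [1] permutes [F] and adds [#|F|%:R] to the sum of all elements. *)
Lemma natr_card_eq0 (F : finFieldType) : #|F|%:R = 0 :> F.
Proof.
apply: (addIr (\sum_(x : F) x)); rewrite add0r.
rewrite [in RHS](reindex_inj (@addrI F 1)) big_split /= sumr_const.
by congr (_%:R + _); apply: eq_card.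
Qed.

Lemma sum_expf_eqN1 (F : finFieldType) (n : nat) :
  (0 < n)%N -> (#|F|.-1 %| n)%N -> \sum_(x : F) x ^+ n = -1.
Proof.
move=> n0 /dvdnP[m nE]; have F1 : (1 < #|F|)%N := finNzRing_gt1 F.
rewrite (bigD1 0) //= expr0n eqn0Ngt n0 add0r.
rewrite (eq_bigr (fun=> 1)) => [|x x0]; last first.
  rewrite nE mulnC exprM; suff -> : x ^+ #|F|.-1 = 1 by rewrite expr1n.
  by apply: (mulfI x0); rewrite -exprS prednK ?(ltnW F1) // expf_card mulr1.
rewrite sumr_const; have -> : #|[pred x : F | x != 0]| = #|F|.-1.
  by rewrite -(cardC1 (0 : F)); apply: eq_card => x; rewrite !inE.
apply/eqP; rewrite -subr_eq0 opprK -[X in _ + X]/(1%:R) -natrD addn1.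
rewrite prednK ?(ltnW F1) //.
by rewrite natr_card_eq0.
Qed.

Lemma bin2_mul2 n : ('C(n, 2) * 2 = n * n.-1)%N.
Proof. by have := bin_ffact n 2; rewrite ffactnS ffactn1. Qed.

(** * Power sums and Hermite's criterion *)

Section QuadraticExtension.

Set Implicit Arguments.
Unset Strict Implicit.

Variables (F : finFieldType) (q : nat).
Hypotheses (q_gt1 : (1 < q)%N) (q_pchar : [pchar F].-nat q).
Hypothesis cardF : #|F| = (q ^ 2)%N.

Lemma conjD (x y : F) : (x + y) ^+ q = x ^+ q + y ^+ q.
Proof. exact: exprDn_pchar. Qed.

Lemma conjN (x : F) : (- x) ^+ q = - x ^+ q.
Proof.
apply: (addIr (x ^+ q)); rewrite -conjD !addNr expr0n.
by case: (q) q_gt1.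
Qed.

Lemma conjB (x y : F) : (x - y) ^+ q = x ^+ q - y ^+ q.
Proof. by rewrite conjD conjN. Qed.

Lemma conjK (x : F) : (x ^+ q) ^+ q = x.
Proof. by rewrite -exprM -[(q * q)%N]/((q ^ 2)%N) -cardF expf_card. Qed.

Lemma natr_q : q%:R = 0 :> F.
Proof.
have := natr_card_eq0 F; rewrite cardF natrX => /eqP.
by rewrite expf_eq0 => /eqP.
Qed.

Definition monomial_sum (u v : nat) : F := \sum_(x : F) x ^+ u * (x ^+ q) ^+ v.

Lemma monomial_sumE u v : monomial_sum u v = \sum_(x : F) x ^+ (u + q * v).
Proof. by apply: eq_bigr => x _; rewrite -exprM -exprD. Qed.

Lemma predn_cardF : #|F|.-1 = ((q - 1) * (q + 1))%N.
Proof. by rewrite cardF; case: (q) q_gt1 => // n _; nia. Qed.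

Lemma monomial_sum0 : monomial_sum 0 0 = 0.
Proof.
rewrite monomial_sumE muln0; under eq_bigr do rewrite expr0.
by rewrite sumr_const -[RHS](natr_card_eq0 F); congr (_%:R); apply: eq_card.
Qed.

(** The exponent [u + q * v] is congruent to [u + v] modulo [q - 1] and to [u - v] modulo [q + 1],
    and both moduli divide [#|F|.-1]. This lemma and the next use one congruence each. *)
Lemma monomial_sum_eq0 u v : ~~ ((q - 1) %| u + v)%N -> monomial_sum u v = 0.
Proof.
move=> h; have uv0 : (0 < u + v)%N by rewrite lt0n; apply: contraNneq h => ->.
rewrite monomial_sumE sum_expf_eq0 //; first nia.
rewrite predn_cardF; apply: contra h => /(dvdn_trans (dvdn_mulr _ (dvdnn _))).
have -> : (u + q * v = u + v + (q - 1) * v)%N by nia.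
by rewrite dvdn_addl // dvdn_mulr.
Qed.

Lemma monomial_sum_skew u v : (v < u)%N -> ~~ ((q + 1) %| u - v)%N ->
  monomial_sum u v = 0.
Proof.
move=> vu h; rewrite monomial_sumE sum_expf_eq0 //; first nia.
rewrite predn_cardF; apply: contra h => /(dvdn_trans (dvdn_mull _ (dvdnn _))).
have -> : (u + q * v = u - v + (q + 1) * v)%N by nia.
by rewrite dvdn_addl // dvdn_mulr.
Qed.

Lemma monomial_sum_low u v : (u + v < 2 * (q - 1))%N -> monomial_sum u v = 0.
Proof.
move=> lt_uv; have [/eqP uv0|uv0] := boolP (u + v == 0)%N.
  have [-> ->] : u = 0%N /\ v = 0%N by split; lia.
  exact: monomial_sum0.
have [/dvdnP[m mE]|] := boolP ((q - 1) %| u + v)%N; last exact: monomial_sum_eq0.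
(* In this remaining degree the exponent is [(q - 1) * (1 + v)] with [0 < 1 + v < q + 1]. *)
have {m}mE : (u + v = q - 1)%N.
  by case: m mE => [|[|m]] mE; [lia | lia | move: mE; rewrite !mulSn; move: (m * _)%N => z; lia].
rewrite monomial_sumE sum_expf_eq0 //; first nia.
have -> : (u + q * v = (q - 1) * (1 + v))%N by nia.
rewrite predn_cardF dvdn_pmul2l; last lia.
by apply/negP => /dvdn_leq; lia.
Qed.

(** The exponent is [(q - 1) * (2 + v)] with [2 <= 2 + v <= 2 * q], hence a multiple of [#|F|.-1]
    only for [2 + v = q + 1]. *)
Lemma monomial_sum_top u v : (u + v = 2 * (q - 1))%N ->
  monomial_sum u v = if v == (q - 1)%N then -1 else 0.
Proof.
move=> uv; rewrite monomial_sumE.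
have E : (u + q * v = (q - 1) * (2 + v))%N by nia.
case: eqP => v1.
  by rewrite sum_expf_eqN1 // ?predn_cardF E ?v1; [nia | apply/dvdnP; exists 1%N; nia].
rewrite sum_expf_eq0 //; first nia.
rewrite predn_cardF E dvdn_pmul2l; last lia.
by apply/negP => /dvdnP[m]; case: m => [|[|m]]; nia.
Qed.

Lemma linear_sum u v (a b : F) :
  \sum_(x : F) x ^+ u * (x ^+ q) ^+ v * (a * x + b * x ^+ q) =
  a * monomial_sum u.+1 v + b * monomial_sum u v.+1.
Proof.
rewrite !mulr_sumr -big_split /=; apply: eq_bigr => x _.
by rewrite !exprS; ring.
Qed.

Lemma quadratic_sum u v (a b a' b' : F) :
  \sum_(x : F) x ^+ u * (x ^+ q) ^+ v *
     ((a * x + b * x ^+ q) * (a' * x + b' * x ^+ q)) =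
  a * a' * monomial_sum u.+2 v + (a * b' + b * a') * monomial_sum u.+1 v.+1
  + b * b' * monomial_sum u v.+2.
Proof.
rewrite !mulr_sumr -!big_split /=; apply: eq_bigr => x _.
by rewrite !exprS; ring.
Qed.

(** Multiplying out one linear form at a time leaves only monomials of total degree [D]. *)
Lemma homogeneous_sum_eq0 D (a b a' b' : F) :
  (forall u v, (u + v = D)%N -> monomial_sum u v = 0) ->
  forall k l u v, (u + v + k + l = D)%N ->
  \sum_(x : F) x ^+ u * (x ^+ q) ^+ v *
     ((a * x + b * x ^+ q) ^+ k * (a' * x + b' * x ^+ q) ^+ l) = 0.
Proof.
move=> hD; elim=> [|k IHk].
  elim=> [|l IHl] u v uvD.
    by under eq_bigr do rewrite !expr0 !mulr1; apply: hD; lia.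
  transitivity (a' * 0 + b' * 0 : F); last by rewrite !mulr0 addr0.
  rewrite -[X in a' * X](IHl u.+1 v); last lia.
  rewrite -[X in b' * X](IHl u v.+1); last lia.
  rewrite !mulr_sumr -!big_split /=; apply: eq_bigr => x _.
  by rewrite !exprS; ring.
move=> l u v uvD.
transitivity (a * 0 + b * 0 : F); last by rewrite !mulr0 addr0.
rewrite -[X in a * X](IHk l u.+1 v); last lia.
rewrite -[X in b * X](IHk l u v.+1); last lia.
rewrite !mulr_sumr -!big_split /=; apply: eq_bigr => x _.
by rewrite !exprS; ring.
Qed.

(** * The trinomial and its Hermite expansion *)

Variables b c : F.

Definition trinomial (x : F) : F := x ^+ (q + 2) + b * x ^+ q + c * x.

Lemma trinomialE x :
  trinomial x = x ^+ 2 * x ^+ q + (c * x + b * x ^+ q).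
Proof. by rewrite /trinomial exprD; ring. Qed.

Lemma conj_trinomialE x :
  trinomial x ^+ q =
  x * (x ^+ q) ^+ 2 + (b ^+ q * x + c ^+ q * x ^+ q).
Proof.
rewrite trinomialE !conjD !exprMn !conjK; set y := x ^+ q.
by ring.
Qed.

(** One choice of [k] linear parts among [i] factors [f x] and of [l] among [j] factors [f x ^+ q].
    For [k <= i] and [l <= j] the summand is homogeneous of degree [3 * (i + j) - 2 * (k + l)]. *)
Definition expansion_sum (i j k l : nat) : F :=
  \sum_(x : F) x ^+ (2 * (i - k) + (j - l)) * (x ^+ q) ^+ ((i - k) + 2 * (j - l))
    * ((c * x + b * x ^+ q) ^+ k * (b ^+ q * x + c ^+ q * x ^+ q) ^+ l).

(** The two zero terms at the end ensure that the indices [0], [1], [2] exist for every [n]. *)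
Lemma exprDn_wide (x y : F) n :
  (x + y) ^+ n = \sum_(k < n.+3) x ^+ (n - k) * y ^+ k *+ 'C(n, k).
Proof.
by rewrite exprDn 2!(big_ord_recr n.+1, big_ord_recr n.+2) /= !bin_small ?mulr0n ?addr0.
Qed.

(** An injective [f] permutes [F], so reindexing by [f] preserves a monomial sum that vanishes by
    its low degree. *)
Lemma hermite_expansion i j : injective trinomial ->
  (i + j < 2 * (q - 1))%N ->
  \sum_(k < i.+3) \sum_(l < j.+3)
    expansion_sum i j k l *+ ('C(i, k) * 'C(j, l)) = 0.
Proof.
move=> f_inj ij; rewrite -[RHS](monomial_sum_low ij) /monomial_sum.
rewrite (reindex_inj f_inj) /=.
transitivity (\sum_(x : F) \sum_(k < i.+3) \sum_(l < j.+3)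
  ((x ^+ 2 * x ^+ q) ^+ (i - k) * (c * x + b * x ^+ q) ^+ k *+ 'C(i, k)) *
  ((x * (x ^+ q) ^+ 2) ^+ (j - l) * (b ^+ q * x + c ^+ q * x ^+ q) ^+ l
     *+ 'C(j, l))); last first.
  apply: eq_bigr => x _; rewrite conj_trinomialE trinomialE.
  by rewrite (exprDn_wide _ _ i) (exprDn_wide _ _ j) big_distrlr.
rewrite [RHS]exchange_big /=. apply: eq_bigr => k _.
rewrite [RHS]exchange_big /=; apply: eq_bigr => l _.
rewrite /expansion_sum -sumrMnl; apply: eq_bigr => x _.
rewrite mulrnAl mulrnAr -mulrnA [('C(j, l) * _)%N]mulnC; congr (_ *+ _).
move: (x ^+ q) (_ ^+ k) (_ ^+ l) (i - k)%N (j - l)%N => y M N m n.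
rewrite (exprD _ (2 * m)) (exprD _ m) !exprM !exprMn.
move: (x ^+ m) (y ^+ m) (x ^+ n) (y ^+ n) => U V W Z.
by ring.
Qed.

Definition expansion_term (i j k l : nat) : F :=
  expansion_sum i j k l *+ ('C(i, k) * 'C(j, l)).

Lemma expansion_term_eq0 i j k l :
  (forall u v, (u + v + 2 * (k + l) = 3 * (i + j))%N -> monomial_sum u v = 0) ->
  expansion_term i j k l = 0.
Proof.
rewrite /expansion_term => hD.
have [ik|ik] := ltnP i k; first by rewrite bin_small.
have [jl|jl] := ltnP j l; first by rewrite (bin_small jl) muln0.
rewrite /expansion_sum (@homogeneous_sum_eq0 (3 * (i + j) - 2 * (k + l))%N).
- by rewrite mul0rn.
- by move=> u v uvD; apply: hD; lia.
- by lia.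
Qed.

Lemma expansion_term_low i j k l :
  (3 * (i + j) < 2 * (q - 1) + 2 * (k + l))%N -> expansion_term i j k l = 0.
Proof.
by move=> lt; apply: expansion_term_eq0 => u v uv; apply: monomial_sum_low; lia.
Qed.

(** Each linear part chosen lowers the degree by two, so three of them bring it below
    [2 * (q - 1)]. *)
Lemma hermite_trinomial i j : injective trinomial ->
  (i + j < 2 * (q - 1))%N -> (3 * (i + j) < 2 * (q - 1) + 6)%N ->
  expansion_term i j 0 0 + expansion_term i j 1 0 + expansion_term i j 0 1
  + expansion_term i j 2 0 + expansion_term i j 1 1 + expansion_term i j 0 2 = 0.
Proof.
move=> f_inj ij ij3; rewrite -[RHS](hermite_expansion f_inj ij).
pose G k l := expansion_term i j k l.
have Z k l : (2 < k + l)%N -> G k l = 0.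
  by move=> kl; apply: expansion_term_low; lia.
have row k : \sum_(l < j.+3) G k l = G k 0%N + G k 1%N + G k 2%N.
  rewrite 3!big_ord_recl big1 ?addr0 ?addrA //= => l _.
  by apply: Z; rewrite /bump /=; lia.
transitivity (\sum_(k < i.+3) (G k 0%N + G k 1%N + G k 2%N)); last first.
  by apply: eq_bigr => k _; rewrite -row.
rewrite 3!big_ord_recl big1 ?addr0 => [|k _]; last first.
  by rewrite !Z ?addr0 // /bump /=; lia.
rewrite !addrA /= /bump /= !addn0 !add1n.
rewrite (Z 1%N 2%N) // (Z 2%N 1%N) // (Z 2%N 2%N) // !addr0 /G.
by ring.
Qed.

Lemma expansion_term00 i j :
  expansion_term i j 0 0 = monomial_sum (2 * i + j) (i + 2 * j).
Proof.
rewrite /expansion_term /expansion_sum !bin0 mulr1n !subn0.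
by apply: eq_bigr => x _; rewrite !expr0 !mulr1.
Qed.

Lemma expansion_term10 i j : expansion_term i.+1 j 1 0 =
  (c * monomial_sum (2 * i + j).+1 (i + 2 * j)
   + b * monomial_sum (2 * i + j) (i + 2 * j).+1) *+ i.+1.
Proof.
rewrite -linear_sum /expansion_term /expansion_sum bin0 bin1 muln1 subn1 subn0.
by congr (_ *+ _); apply: eq_bigr => x _; rewrite expr0 mulr1.
Qed.

Lemma expansion_term01 i j : expansion_term i j.+1 0 1 =
  (b ^+ q * monomial_sum (2 * i + j).+1 (i + 2 * j)
   + c ^+ q * monomial_sum (2 * i + j) (i + 2 * j).+1) *+ j.+1.
Proof.
rewrite -linear_sum /expansion_term /expansion_sum bin0 bin1 mul1n subn1 subn0.
by congr (_ *+ _); apply: eq_bigr => x _; rewrite expr0 mul1r.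
Qed.

Lemma expansion_term20 i j : expansion_term i.+2 j 2 0 =
  (c * c * monomial_sum (2 * i + j).+2 (i + 2 * j)
   + (c * b + b * c) * monomial_sum (2 * i + j).+1 (i + 2 * j).+1
   + b * b * monomial_sum (2 * i + j) (i + 2 * j).+2) *+ 'C(i.+2, 2).
Proof.
rewrite -quadratic_sum /expansion_term /expansion_sum bin0 muln1 subn2 subn0.
by congr (_ *+ _); apply: eq_bigr => x _; rewrite expr0 mulr1.
Qed.

Lemma expansion_term11 i j : expansion_term i.+1 j.+1 1 1 =
  (c * b ^+ q * monomial_sum (2 * i + j).+2 (i + 2 * j)
   + (c * c ^+ q + b * b ^+ q) * monomial_sum (2 * i + j).+1 (i + 2 * j).+1
   + b * c ^+ q * monomial_sum (2 * i + j) (i + 2 * j).+2) *+ (i.+1 * j.+1).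
Proof.
rewrite -quadratic_sum /expansion_term /expansion_sum !bin1 !subn1.
by congr (_ *+ _); apply: eq_bigr => x _.
Qed.

Lemma expansion_term02 i j : expansion_term i j.+2 0 2 =
  (b ^+ q * b ^+ q * monomial_sum (2 * i + j).+2 (i + 2 * j)
   + (b ^+ q * c ^+ q + c ^+ q * b ^+ q)
     * monomial_sum (2 * i + j).+1 (i + 2 * j).+1
   + c ^+ q * c ^+ q * monomial_sum (2 * i + j) (i + 2 * j).+2) *+ 'C(j.+2, 2).
Proof.
rewrite -quadratic_sum /expansion_term /expansion_sum bin0 mul1n subn2 subn0.
by congr (_ *+ _); apply: eq_bigr => x _; rewrite expr0 mul1r.
Qed.

(** * Consequences of injectivity according to [q] modulo 3 *)

Lemma trinomial_mod3_neq1 : injective trinomial -> (q %% 3 != 1)%N.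
Proof.
move=> f_inj; apply/eqP => q1; pose k := (q %/ 3)%N.
have qE : q = (3 * k + 1)%N by rewrite /k; lia.
have := @hermite_trinomial k k f_inj.
rewrite (@expansion_term_low k k 1 0) ?(@expansion_term_low k k 0 1)
  ?(@expansion_term_low k k 2 0) ?(@expansion_term_low k k 1 1)
  ?(@expansion_term_low k k 0 2) ?addr0; try lia.
rewrite expansion_term00 monomial_sum_top; last lia.
have -> : (k + 2 * k == q - 1)%N by lia.
by move=> h; have /eqP := h ltac:(lia) ltac:(lia); rewrite oppr_eq0 oner_eq0.
Qed.

(** The degree exceeds [2 * (q - 1)] by two, so at most one linear part is chosen. Only the monomial
    with both exponents [q - 1] survives, and it contributes [- b] with multiplicity [r + 1]. *)
Lemma trinomial_mod3_eq0 r : injective trinomial -> (0 < r)%N -> q = (3 * r)%N ->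
  (r + 1)%:R != 0 :> F -> b = 0.
Proof.
move=> f_inj r0 qE r1.
have := @hermite_trinomial r.+1 r.-1 f_inj.
rewrite (@expansion_term_low r.+1 r.-1 2 0) ?(@expansion_term_low r.+1 r.-1 1 1)
  ?(@expansion_term_low r.+1 r.-1 0 2) ?addr0; try lia.
rewrite expansion_term00 monomial_sum_skew; [|lia|]; last first.
  by apply/negP => /dvdn_leq; lia.
have -> : expansion_term r.+1 r.-1 0 1 = 0.
  (* For [r = 1] the second index is [0] and the binomial coefficient vanishes. *)
  case: r r0 qE r1 => [|[|r]] //= _ qE r1.
  rewrite expansion_term01 !monomial_sum_top; try lia.
  by rewrite !ifN_eq ?mulr0 ?addr0 ?mul0rn //; lia.
rewrite expansion_term10 !monomial_sum_top; try lia.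
rewrite ifN_eq ?ifT; try lia.
rewrite mulr0 add0r addr0 add0r mulrN1 -mulr_natr => h.
have /eqP := h ltac:(lia) ltac:(lia).
by rewrite mulf_eq0 oppr_eq0 -addn1 (negPf r1) orbF => /eqP.
Qed.

(* Unlike [mulr_natr], usable to rewrite repeatedly, since [n%:R] is [1 *+ n]. *)
Lemma mulrn_factor n : exists z : F, forall x, x *+ n = x * z.
Proof. by exists n%:R => x; rewrite mulr_natr. Qed.

Lemma monomial_sum_diag n : (0 < n)%N -> ~~ ((q - 1) %| n)%N ->
  monomial_sum n n = 0.
Proof.
move=> n0 h; rewrite monomial_sumE sum_expf_eq0 //; first nia.
have -> : (n + q * n = n * (q + 1))%N by nia.
by rewrite predn_cardF dvdn_pmul2r //; lia.
Qed.

(** The degree is [2 * (q - 1) + 2], not a multiple of [q - 1] when [3 < q]. *)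
Lemma expansion_term_linear i j k l : (3 < q)%N -> (k + l = 1)%N ->
  (3 * (i + j) = 2 * (q + 1))%N -> expansion_term i j k l = 0.
Proof.
move=> q3 kl ij; apply: expansion_term_eq0 => u v uv; apply: monomial_sum_eq0.
have -> : (u + v = (q - 1) * 2 + 2)%N by lia.
by rewrite dvdn_addr ?dvdn_mulr //; apply/negP => /dvdn_leq; lia.
Qed.

(** In the expansion for [(s, s)] two linear parts must be chosen; the identity collects the
    coefficients of the monomial with both exponents [q - 1]. *)
Lemma trinomial_mod3_eq2_norm s : injective trinomial -> (1 < s)%N ->
  q.+1 = (3 * s)%N ->
  (c ^+ 2 + (c ^+ q) ^+ 2) *+ 'C(s, 2) + (c * c ^+ q + b * b ^+ q) *+ (s * s) = 0.
Proof.
move=> f_inj s1 qE; have := @hermite_trinomial s s f_inj.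
rewrite (@expansion_term_linear s s 1 0) ?(@expansion_term_linear s s 0 1); try lia.
rewrite expansion_term00.
have [-> ->] : (2 * s + s = q + 1 /\ s + 2 * s = q + 1)%N by lia.
rewrite monomial_sum_diag ?add0r; [|lia|]; last first.
  have -> : (q + 1 = (q - 1) * 1 + 2)%N by lia.
  by rewrite dvdn_addr ?dvdn_mulr //; apply/negP => /dvdn_leq; lia.
have [m sE] : exists m, s = m.+2 by exists (s - 2)%N; lia.
rewrite {}sE in s1 qE *.
rewrite expansion_term20 expansion_term11 expansion_term02 !monomial_sum_top; try lia.
repeat (case: eqP => ?; try lia).
move=> h; have {h} := h ltac:(lia) ltac:(lia) => h.
move: h; move: 'C(m.+2, 2) (m.+2 * m.+2)%N => k l h.
have [z zE] := mulrn_factor k; have [w wE] := mulrn_factor l.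
by apply: oppr_inj; rewrite oppr0 -[RHS]h !zE !wE; ring.
Qed.

(** The same extraction for [(s + 1, s - 1)]; there the choice of two conjugate linear parts misses
    the monomial with both exponents [q - 1]. *)
Lemma trinomial_mod3_eq2_skew s : injective trinomial -> (1 < s)%N ->
  q.+1 = (3 * s)%N ->
  b * (c *+ s + c ^+ q *+ s.-1) *+ s.+1 = 0.
Proof.
move=> f_inj s1 qE; have := @hermite_trinomial s.+1 s.-1 f_inj.
rewrite (@expansion_term_linear s.+1 s.-1 1 0)
  ?(@expansion_term_linear s.+1 s.-1 0 1); try lia.
rewrite expansion_term00 monomial_sum_skew; [|lia|]; last first.
  by apply/negP => /dvdn_leq; lia.
have -> : expansion_term s.+1 s.-1 0 2 = 0.
  case: s s1 qE => [|[|[|s]]] //= _ qE.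
  rewrite expansion_term02 !monomial_sum_top; try lia.
  by rewrite !ifN_eq ?mulr0 ?addr0 ?mul0rn //; lia.
have [m sE] : exists m, s = m.+2 by exists (s - 2)%N; lia.
rewrite {}sE in s1 qE *.
rewrite /= expansion_term20 expansion_term11 !monomial_sum_top; try lia.
repeat (case: eqP => ?; try lia).
move=> h; have {h} := h ltac:(lia) ltac:(lia) => h.
rewrite [b * c]mulrC -[c * b + _]mulr2n !mulr0 !add0r !addr0 !mulrN1 !mulNrn -!mulrnA in h.
rewrite mulnC bin2_mul2 -opprD in h; move/eqP: h; rewrite oppr_eq0 => /eqP h.
rewrite -[RHS]h mulrDr mulrnDl !mulrnAr -!mulrnA [c * b]mulrC /=.
by rewrite -!(mulnC m.+3).
Qed.


(** In [F] one has [3 s = 1], and [9 * 'C(s, 2) = -1] because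
    [2 * (9 * 'C(s, 2) + 1) = q * (q - 1)]. The parity alternative makes half of [q * (q - 1)]
    vanish in [F]. Nine times the previous norm identity is then the claim. *)
Lemma trinomial_norm_relation s : injective trinomial -> (1 < s)%N ->
  q.+1 = (3 * s)%N -> odd q \/ 2%:R = 0 :> F /\ (4 %| q)%N ->
  c ^+ 2 + (c ^+ q) ^+ 2 = c * c ^+ q + b * b ^+ q.
Proof.
move=> f_inj s1 qE q_even; have := trinomial_mod3_eq2_norm f_inj s1 qE.
move: (c ^+ 2 + _) (c * _ + _) => A B h.
have binE : ((9 * 'C(s, 2) + 1) * 2 = q * (q - 1))%N.
  by have := bin2_mul2 s; rewrite -subn1 => ?; nia.
have bin0 : (9 * 'C(s, 2) + 1)%:R = 0 :> F.
  case: q_even => [q_odd|[two0 /dvdnP[m mE]]].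
    have q2 : (q - 1 = q./2 * 2)%N by lia.
    have -> : (9 * 'C(s, 2) + 1 = q * q./2)%N.
      by apply/eqP; rewrite -(eqn_pmul2r (isT : 0 < 2)%N) binE q2 mulnA.
    by rewrite natrM natr_q mul0r.
  have -> : (9 * 'C(s, 2) + 1 = 2 * (m * (q - 1)))%N.
    apply/eqP; rewrite -(eqn_pmul2r (isT : 0 < 2)%N) binE {1}mE.
    by apply/eqP; move: (q - 1)%N => z; ring.
  by rewrite natrM two0 mul0r.
have s3 : 3%:R * s%:R = 1 :> F by rewrite -natrM -qE -addn1 natrD natr_q add0r.
have : A * (9%:R * 'C(s, 2)%:R + 1 - 1) + B * (3%:R * s%:R) ^+ 2 = 0.
  rewrite -[RHS](mulr0 9%:R) -[X in _ = _ * X]h -(mulr_natr A) -(mulr_natr B) natrM.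
  by ring.
rewrite -natrM -[X in _ + X - 1]/(1%:R) -natrD bin0 s3 => E.
by apply/eqP; rewrite -subr_eq0 -oppr_eq0 -[X in _ == X]E; apply/eqP; ring.
Qed.

Lemma trinomial_mod3_eq2_odd s : injective trinomial -> (1 < s)%N ->
  q.+1 = (3 * s)%N -> odd q -> 2%:R != 0 :> F -> b = 0.
Proof.
move=> f_inj s1 qE q_odd two0.
have R := trinomial_norm_relation f_inj s1 qE (or_introl q_odd).
have s3 : 3%:R * s%:R = 1 :> F by rewrite -natrM -qE -addn1 natrD natr_q add0r.
have three0 : 3%:R != 0 :> F.
  by apply: contraTneq (oner_neq0 F) => z; rewrite -s3 z mul0r eqxx.
(* Nine times the skew identity, with [3 s = 1]; the last factor [4] comes from [3 (s + 1)]. *)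
have : b * (c - 2%:R * c ^+ q) * 2%:R ^+ 2 = 0.
  have := trinomial_mod3_eq2_skew f_inj s1 qE.
  rewrite -(mulr_natr _ s.+1) -(mulr_natr _ s) -(mulr_natr _ s.-1).
  have -> : s.-1%:R = s%:R - 1 :> F by rewrite -subn1 natrB // ltnW.
  rewrite -addn1 natrD; move: (c ^+ q) (s%:R : F) s3 => d z z3 h.
  rewrite -[RHS](mulr0 9%:R) -[X in _ = _ * X]h.
  transitivity (b * (3%:R * z * c + (3%:R * z - 3%:R) * d) * (3%:R * z + 3%:R));
    last by ring.
  by rewrite z3; ring.
move/eqP; rewrite !mulf_eq0 (negPf two0) !orbF subr_eq0.
case/orP=> /eqP // cE.
(* Conjugating [c = 2 c ^+ q] gives [c ^+ q = 2 c], hence [c = 4 c]. *)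
have c0 : c = 0.
  have cE' : c ^+ q = 2%:R * c.
    rewrite {1}cE exprMn conjK; congr (_ * _).
    by rewrite -[2%:R]/(1 + 1) conjD expr1n.
  have /eqP : 3%:R * c = 0.
    transitivity (2%:R * (2%:R * c) - c); first by ring.
    by rewrite -cE' -cE subrr.
  by rewrite mulf_eq0 (negPf three0) => /eqP.
move: R; rewrite c0 expr0n /= expr0n.
case: (q) q_gt1 => // q' _; rewrite expr0n /= mul0r !add0r => /esym/eqP.
by rewrite mulf_eq0 expf_eq0 /= => /orP[] /eqP.
Qed.

Lemma pchar_dvd_q p : prime p -> (p %| q)%N -> p \in [pchar F].
Proof. by move=> p_pr /pnat_dvd/(_ q_pchar); rewrite pnatE. Qed.

(** * The norm onto the subfield of order [q] *)

Lemma conj_norm (x : F) : (x * x ^+ q) ^+ q = x * x ^+ q.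
Proof. by rewrite exprMn conjK mulrC. Qed.

(** Norm fibres on the [(q - 1) * (q + 1)] nonzero elements have at most [q + 1] elements, so the
    image fills the at most [q - 1] nonzero fixed elements. *)
Lemma norm_surj (n : F) : n ^+ q = n -> exists x : F, x * x ^+ q = n.
Proof.
move=> nK; have [->|n0] := eqVneq n 0; first by exists 0; rewrite mul0r.
pose U := [set x : F | x != 0].
pose V := [set z : F | (z != 0) && (z ^+ q == z)].
have U_card : #|U| = ((q - 1) * (q + 1))%N.
  by rewrite -predn_cardF -(cardC1 (0 : F)); apply: eq_card => x; rewrite !inE.
have imUV : [set x * x ^+ q | x in U] \subset V.
  apply/subsetP => z /imsetP[x]; rewrite !inE => x0 ->.
  by rewrite conj_norm eqxx andbT mulf_neq0 // expf_neq0.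
have V_card : (#|V| <= q - 1)%N.
  apply: (@card_roots_leq F ('X^(q - 1) - 1)).
  - by rewrite -size_poly_eq0 size_XnsubC //; lia.
  - by rewrite size_XnsubC //; lia.
  move=> z; rewrite !inE /root !hornerE => /andP[z0 /eqP zq].
  by rewrite subr_eq0; apply/eqP/(mulfI z0); rewrite -exprS subn1 prednK ?mulr1 // ltnW.
have im_card : (#|U| <= (q + 1) * #|[set (x * x ^+ q)%R | x in U]|)%N.
  apply: leq_card_fibers => y.
  apply: (@card_roots_leq F ('X^(q + 1) - y%:P)).
  - by rewrite -size_poly_eq0 size_XnsubC //; lia.
  - by rewrite size_XnsubC //; lia.
  by move=> x; rewrite !inE /root !hornerE => /andP[_ /eqP <-]; rewrite addn1 exprS subrr.
have VU : V \subset [set x * x ^+ q | x in U].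
  rewrite -(geq_leqif (subset_leqif_card imUV)); apply: leq_trans V_card _.
  by move: im_card; rewrite U_card mulnC addn1 leq_pmul2l.
have /(subsetP VU)/imsetP[x _ ->] : n \in V by rewrite !inE n0 nK eqxx.
by exists x.
Qed.

Lemma conj_eq0 (x : F) : (x ^+ q == 0) = (x == 0).
Proof. by rewrite expf_eq0 ltnW. Qed.

(** * The case [b = 0] *)

Section ZeroB.

Hypothesis b0 : b = 0.

Definition norm_cubic (n : F) : F := n * (n + c) * (n + c ^+ q).

Lemma trinomial_b0 x : trinomial x = x * (x * x ^+ q + c).
Proof. by rewrite trinomialE b0; ring. Qed.

Lemma norm_trinomial x :
  trinomial x * trinomial x ^+ q = norm_cubic (x * x ^+ q).
Proof.
rewrite trinomial_b0 exprMn conjD conj_norm /norm_cubic.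
by move: (x ^+ q) (c ^+ q) => y d; ring.
Qed.

Lemma norm_cubic_inj n m : injective trinomial -> n ^+ q = n -> m ^+ q = m ->
  norm_cubic n = norm_cubic m -> n = m.
Proof.
move=> f_inj.
(* If both [n + c] and [m + c] vanish, then [n = m] already; otherwise the symmetry allows division
   by [m + c]. *)
wlog m_c : n m / m + c != 0 => [W nK mK nm|].
  have [mc|] := eqVneq (m + c) 0; last by move/W; apply.
  have [nc|/W H] := eqVneq (n + c) 0; last by apply/esym/H.
  by apply: (addIr c); rewrite mc nc.
move=> nK mK nm; have [x xn] := norm_surj nK.
(* Solves [y * (m + c) = x * (n + c)], so that [y] has norm [m] and the same image as [x]. *)
pose y := x * ((n + c) / (m + c)).
have m_cq : m + c ^+ q != 0 by rewrite -mK -conjD conj_eq0.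
have ym : y * y ^+ q = m.
  rewrite /y !exprMn exprVn !conjD nK mK.
  transitivity (norm_cubic n / ((m + c) * (m + c ^+ q))).
    by rewrite /norm_cubic -xn; field; rewrite m_c m_cq.
  by rewrite nm /norm_cubic; field; rewrite m_c m_cq.
have : trinomial y = trinomial x.
  by rewrite !trinomial_b0 ym xn /y -mulrA divfK.
by move/f_inj => yx; rewrite -xn -ym yx.
Qed.

(** Equal images give a common norm [n], and [x * (n + c)] determines [x] unless [n = - c]. In that
    case [c] is fixed by conjugation, and the relation forces [c = 0]. *)
Lemma norm_cubic_trinomial_inj : c ^+ 2 + (c ^+ q) ^+ 2 = c * c ^+ q ->
  (forall n m, n ^+ q = n -> m ^+ q = m -> norm_cubic n = norm_cubic m -> n = m) ->
  injective trinomial.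
Proof.
move=> cE g_inj x y fxy.
have nxy : x * x ^+ q = y * y ^+ q.
  by apply: g_inj; rewrite ?conj_norm // -!norm_trinomial fxy.
move: fxy; rewrite !trinomial_b0 -nxy.
have [nc|nc] := eqVneq (x * x ^+ q + c) 0; last by move/(mulIf nc).
have cn : c = - (x * x ^+ q) by apply/eqP; rewrite -addr_eq0 addrC nc.
have cK : c ^+ q = c by rewrite cn conjN conj_norm.
have c0 : c = 0.
  move: cE; rewrite cK -expr2 => /(canRL (addrK _)); rewrite subrr => /eqP.
  by rewrite expf_eq0 => /eqP.
move: nc nxy; rewrite c0 addr0 => -> /esym/eqP + _.
rewrite mulf_eq0 conj_eq0 orbb => /eqP ->.
by apply/eqP; move/eqP: (esym cn); rewrite c0 oppr_eq0 mulf_eq0 conj_eq0 orbb.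
Qed.

(** For a fixed element, [n ^+ 2 = n ^+ q.+1 = (n ^+ 3) ^+ s]. *)
Lemma cube_inj s n m : q.+1 = (3 * s)%N -> n ^+ q = n -> m ^+ q = m ->
  n ^+ 3 = m ^+ 3 :> F -> n = m.
Proof.
move=> qE nK mK nm3.
have nm2 : n ^+ 2 = m ^+ 2.
  by rewrite !expr2 -{2}nK -{2}mK -!exprS qE !exprM nm3.
have [n0|n0] := eqVneq n 0.
  by move/esym/eqP: nm2; rewrite n0 expr0n /= expf_eq0 /= => /eqP.
by apply: (@mulIf _ (n ^+ 2)); rewrite ?expf_neq0 // -exprS nm3 nm2 -exprS.
Qed.

Lemma trinomial_inj : (q %% 3 != 1)%N ->
  c ^+ 2 + (c ^+ q) ^+ 2 = c * c ^+ q -> injective trinomial.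
Proof.
move=> q1 cE; apply: norm_cubic_trinomial_inj => // n m nK mK.
have [q3|q3] := boolP (3 %| q)%N.
  have /pcharf0 three0 : 3%N \in [pchar F] by apply: pchar_dvd_q.
  have /eqP : (c + c ^+ q) ^+ 2 = 0.
    transitivity (c ^+ 2 + (c ^+ q) ^+ 2 + 2%:R * (c * c ^+ q)); first by ring.
    by rewrite cE; transitivity (3%:R * (c * c ^+ q)); [ring | rewrite three0 mul0r].
  rewrite expf_eq0 /= addrC addr_eq0 => /eqP cK.
  rewrite /norm_cubic cK => nm.
  (* In characteristic 3 the cubic is [n ^+ 3 - c ^+ 2 * n], which is additive in [n]. *)
  have : (n - m) * ((n - m - c) * (n - m + c)) = 0.
    transitivity (n * (n + c) * (n - c) - m * (m + c) * (m - c)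
       - 3%:R * (n * m * (n - m))); last by rewrite nm three0; ring.
    by ring.
  move/eqP; rewrite !mulf_eq0 !subr_eq0 addr_eq0 => /orP[/eqP //|nmc].
  have cK' : c ^+ q = c.
    by case/orP: nmc => /eqP E; [rewrite -E | rewrite -[c]opprK -E conjN];
       rewrite conjB nK mK.
  have c0 : c = 0.
    have : 3%:R * c = 0 by rewrite three0 mul0r.
    have -> : 3%:R * c = c + (c + c) by ring.
    by rewrite -{3}cK' cK subrr addr0.
  by apply/eqP; move: nmc; rewrite c0 oppr0 orbb subr_eq0.
have [s qE] : exists s, q.+1 = (3 * s)%N by exists (q.+1 %/ 3)%N; lia.
have s3 : 3%:R * s%:R = 1 :> F by rewrite -natrM -qE -addn1 natrD natr_q add0r.
have three0 : 3%:R != 0 :> F.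
  by apply: contraTneq (oner_neq0 F) => z; rewrite -s3 z mul0r eqxx.
move=> nm; pose t := c + c ^+ q.
have tK : t ^+ q = t by rewrite /t conjD conjK addrC.
have threeK : 3%:R ^+ q = 3%:R :> F by rewrite !mulrS !mulr0n addr0 !conjD !expr1n.
(* The relation on [c] is exactly what completes the cube. *)
have cubeE k : (3%:R * k + t) ^+ 3 = 27%:R * norm_cubic k + t ^+ 3.
  transitivity (27%:R * norm_cubic k + t ^+ 3
    + 9%:R * k * (c ^+ 2 + (c ^+ q) ^+ 2 - c * c ^+ q)).
    by rewrite /norm_cubic /t; move: (c ^+ q) => d; ring.
  by rewrite cE subrr mulr0 addr0.
apply: (mulfI three0); apply: (addIr t); apply: (cube_inj qE).
- by rewrite conjD exprMn threeK nK tK.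
- by rewrite conjD exprMn threeK mK tK.
by rewrite !cubeE nm.
Qed.

Lemma trinomial_pchar3_trace : injective trinomial -> 3%:R = 0 :> F ->
  c + c ^+ q = 0.
Proof.
move=> f_inj three0; pose t := c + c ^+ q.
apply/eqP/negPn/negP; rewrite -/t => t0.
have tK : t ^+ q = t by rewrite /t conjD conjK addrC.
(* In characteristic 3, [norm_cubic (w + 1) - norm_cubic (w - 1)] is
   [2 (1 + c * c ^+ q - t * w)]. *)
pose w := (1 + c * c ^+ q) / t.
have wK : w ^+ q = w by rewrite /w exprMn exprVn conjD expr1n tK conj_norm.
have : w + 1 = w - 1.
  apply: norm_cubic_inj => //; first by rewrite conjD expr1n wK.
    by rewrite conjB expr1n wK.
  have tE : t * w = 1 + c * c ^+ q by rewrite /w mulrCA mulfV ?mulr1.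
  apply/eqP; rewrite -subr_eq0 /norm_cubic; apply/eqP.
  transitivity (3%:R * (2%:R * w ^+ 2 + 2%:R * (t * w)) - 2%:R * (t * w - (1 + c * c ^+ q)));
    first by rewrite /t; move: (c ^+ q) => d; ring.
  by rewrite three0 tE; ring.
move/addrI/eqP; rewrite -subr_eq0 opprK => /eqP two0.
have /eqP := three0; rewrite (_ : 3%:R = 1 + 1 + 1 :> F); last by ring.
by rewrite two0 add0r oner_eq0.
Qed.

End ZeroB.

(** With [w = c ^+ (q - 1)] both sides have the factor [w ^+ 2 - w + 1]; the cofactors [w] and
    [c ^+ 2] vanish together. *)
Lemma root_cubicP :
  root ('X^3 - 'X^2 + 'X : {poly F}) (c ^+ (q - 1)) <->
  c ^+ 2 + (c ^+ q) ^+ 2 = c * c ^+ q.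
Proof.
pose w := c ^+ (q - 1).
have cqE : c ^+ q = c * w by rewrite /w -exprS subn1 prednK // ltnW.
have rE : ('X^3 - 'X^2 + 'X : {poly F}).[w] = w * (w ^+ 2 - w + 1).
  by rewrite !hornerE /=; ring.
have nE : c ^+ 2 + (c ^+ q) ^+ 2 - c * c ^+ q = c ^+ 2 * (w ^+ 2 - w + 1).
  by rewrite cqE; ring.
have wc : (w == 0) = (c == 0) by rewrite /w expf_eq0 subn_gt0 q_gt1.
rewrite /root -/w rE; split=> [|/eqP].
  rewrite mulf_eq0 wc => h.
  by apply/eqP; rewrite -subr_eq0 nE mulf_eq0 expf_eq0.
by rewrite -subr_eq0 nE mulf_eq0 expf_eq0 /= mulf_eq0 wc.
Qed.

(** * Characteristic 2 *)

Section PcharTwo.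

Hypotheses (two0 : 2%:R = 0 :> F) (q_mod3 : (q %% 3 = 2)%N) (q_gt2 : (2 < q)%N).

Lemma addxx (x : F) : x + x = 0.
Proof. by rewrite -mulr2n -mulr_natr two0 mulr0. Qed.

Lemma sqrD (x y : F) : (x + y) ^+ 2 = x ^+ 2 + y ^+ 2.
Proof. by rewrite sqrrD -mulr_natr two0 mulr0 addr0. Qed.

(** [w] is a power [a ^+ (#|F|.-1 %/ 3)] other than [1]; conjugation squares it because [q] is 2
    modulo 3. *)
Lemma exists_F4_generator : exists w w' : F,
  [/\ w + w' = 1, w * w' = 1, w ^+ 2 = w' /\ w' ^+ 2 = w
    & w ^+ q = w' /\ w' ^+ q = w].
Proof.
pose n := (#|F|.-1 %/ 3)%N.
have nE : #|F|.-1 = (3 * n)%N.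
  rewrite mulnC divnK // predn_cardF dvdn_mull //.
  by rewrite /dvdn -modnDml q_mod3.
have q8 : (3 <= (q - 1) * (q + 1))%N by nia.
have [|a a0 an] := @exists_expf_neq1 F n; first by move: nE; rewrite predn_cardF; lia.
pose w := a ^+ n; exists w, (w ^+ 2).
have w3 : w ^+ 3 = 1.
  rewrite -exprM mulnC -nE; apply: (mulfI a0).
  by rewrite -exprS prednK ?expf_card ?mulr1 // ltnW // finNzRing_gt1.
have wq : w ^+ q = w ^+ 2.
  by rewrite (divn_eq q 3) q_mod3 exprD mulnC exprM w3 expr1n mul1r.
have w4 : (w ^+ 2) ^+ 2 = w.
  by rewrite -exprM -[(2 * 2)%N]/4%N exprS w3 mulr1.
have w12 : w ^+ 2 + w + 1 = 0.
  have /eqP : (w - 1) * (w ^+ 2 + w + 1) = 0.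
    by transitivity (w ^+ 3 - 1); [ring | rewrite w3 subrr].
  by rewrite mulf_eq0 subr_eq0 (negPf an) => /eqP.
split.
- by rewrite -[LHS]addr0 -(addxx 1) addrA [w + _]addrC w12 add0r.
- by rewrite -w3 exprS.
- by [].
- by split=> //; rewrite exprAC wq.
Qed.

Definition artin_schreier (z : F) := [exists v : F, (v ^+ q == v) && (v ^+ 2 + v == z)].

Lemma artin_schreierP z : reflect (exists2 v, v ^+ q = v & v ^+ 2 + v = z) (artin_schreier z).
Proof.
apply: (iffP existsP) => [[v /andP[/eqP vK /eqP vz]]|[v vK vz]]; first by exists v.
by exists v; rewrite vK vz !eqxx.
Qed.

Lemma artin_schreier0 : artin_schreier 0.
Proof. by apply/artin_schreierP; exists 0; rewrite expr0n ?addr0 //; case: (q) q_gt1. Qed.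

Lemma artin_schreierD y z : artin_schreier y -> artin_schreier z -> artin_schreier (y + z).
Proof.
move=> /artin_schreierP[u uK <-] /artin_schreierP[v vK <-]; apply/artin_schreierP; exists (u + v).
  by rewrite conjD uK vK.
by rewrite sqrD; ring.
Qed.

Lemma artin_schreier_sqr z : artin_schreier z -> artin_schreier (z ^+ 2).
Proof.
move=> /artin_schreierP[u uK <-]; apply/artin_schreierP; exists (u ^+ 2); first by rewrite exprAC uK.
by rewrite sqrD.
Qed.

(** A solution would be a cube root of unity, and [v ^+ q = v ^+ 2] would force [v ^+ 2 = v]. *)
Lemma artin_schreier1N : ~~ artin_schreier 1.
Proof.
apply/artin_schreierP => -[v vK v1].
have v3 : v ^+ 3 = 1.
  apply/eqP; rewrite -subr_eq0; apply/eqP.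
  transitivity ((v - 1) * (v ^+ 2 + v + 1)); first by ring.
  by rewrite v1 addxx mulr0.
have v2 : v ^+ 2 = v.
  by rewrite -[RHS]vK (divn_eq q 3) q_mod3 exprD mulnC exprM v3 expr1n mul1r.
by move/eqP: v1; rewrite v2 addxx eq_sym oner_eq0.
Qed.

Definition fixed_set : {set F} := [set x | x ^+ q == x].

(** The roots of ['X^q - 'X] give the upper bound; the trace, with fibres of at most [q] elements,
    gives the lower one. *)
Lemma card_fixed_set : #|fixed_set| = q.
Proof.
apply/eqP; rewrite eqn_leq; apply/andP; split.
  have sP : size ('X^q - 'X : {poly F}) = q.+1.
    by rewrite size_polyDl size_polyXn // size_polyN size_polyX ltnS.
  apply: (@card_roots_leq F ('X^q - 'X)); rewrite -?size_poly_eq0 ?sP //.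
  by move=> x; rewrite inE /root !hornerE subr_eq0.
have im_sub : [set x ^+ q + x | x in [set: F]] \subset fixed_set.
  by apply/subsetP => y /imsetP[x _ ->]; rewrite inE conjD conjK addrC.
apply: leq_trans (subset_leq_card im_sub).
rewrite -(leq_pmul2l (ltnW q_gt1)).
have -> : (q * q)%N = #|[set: F]| by rewrite cardsT cardF.
apply: leq_card_fibers => y.
have sP : size ('X^q + ('X - y%:P) : {poly F}) = q.+1.
  by rewrite size_polyDl size_polyXn // size_XsubC ltnS.
apply: (@card_roots_leq F ('X^q + ('X - y%:P))); rewrite -?size_poly_eq0 ?sP //.
by move=> x; rewrite !inE /root !hornerE => /eqP <-; rewrite /= subrr.
Qed.

(** The image [H] of [v ^+ 2 + v] has at least half of the subfield and omits [1], so [H] and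
    [1 + H] partition the subfield. *)
Lemma artin_schreier_index2 z : z ^+ q = z -> artin_schreier z || artin_schreier (1 + z).
Proof.
move=> zK; pose H := [set v ^+ 2 + v | v in fixed_set].
pose H' := [set 1 + v | v in H].
have HP v : (v \in H) = artin_schreier v.
  apply/imsetP/artin_schreierP => [[u]|[u uK uv]]; first by rewrite inE => /eqP ? ->; exists u.
  by exists u; rewrite ?inE ?uK.
have H'P v : (v \in H') = artin_schreier (1 + v).
  apply/imsetP/idP => [[u]|vH]; first by rewrite HP => uH ->; rewrite addrA addxx add0r.
  by exists (1 + v); rewrite ?HP // addrA addxx add0r.
have HK v : artin_schreier v -> v \in fixed_set.
  by move=> /artin_schreierP[u uK <-]; rewrite inE conjD exprAC uK.
have sub : H :|: H' \subset fixed_set.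
  apply/subsetP => v; rewrite inE HP H'P => /orP[/HK //|/HK].
  by rewrite !inE conjD expr1n (inj_eq (addrI 1)).
have cHH' : #|H :|: H'| = (#|H| + #|H'|)%N.
  rewrite cardsU (_ : H :&: H' = set0) ?cards0 ?subn0 //.
  apply/setP => v; rewrite !inE HP H'P; apply/negP => /andP[h1 h2].
  by move/negP: artin_schreier1N; apply; have := artin_schreierD h2 h1; rewrite -addrA addxx addr0.
have cH' : #|H'| = #|H| by apply: card_imset; apply: addrI.
have cH : (#|fixed_set| <= 2 * #|H|)%N.
  apply: leq_card_fibers => y.
  have sP : size ('X^2 + ('X - y%:P) : {poly F}) = 3.
    by rewrite size_polyDl size_polyXn // size_XsubC.
  apply: (@card_roots_leq F ('X^2 + ('X - y%:P))); rewrite -?size_poly_eq0 ?sP //.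
  by move=> x; rewrite !inE /root !hornerE => /andP[_ /eqP <-]; apply/eqP => /=; ring.
have : fixed_set \subset H :|: H'.
  by rewrite -(geq_leqif (subset_leqif_card sub)) cHH' cH' addnn -mul2n.
by move/subsetP/(_ z); rewrite inE zK eqxx in_setU HP H'P; apply.
Qed.

(** One of [a^-1], [a'^-1] and their sum works: if the first two fail, index two makes [a' / a] and
    [a / a'] solvable. *)
Lemma exists_scale_artin_schreier a a' : a ^+ q = a -> a' ^+ q = a' -> a != 0 -> a' != 0 ->
  exists z, [/\ z ^+ q = z, artin_schreier (1 + a * z) & artin_schreier (1 + a' * z)].
Proof.
move=> aK a'K a0 a'0.
have divK : (a' / a) ^+ q = a' / a by rewrite exprMn exprVn aK a'K.
have divK' : (a / a') ^+ q = a / a' by rewrite exprMn exprVn aK a'K.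
have [h|h] := boolP (artin_schreier (1 + a' / a)).
  by exists a^-1; rewrite exprVn aK mulfV // addxx artin_schreier0.
have [h'|h'] := boolP (artin_schreier (1 + a / a')).
  by exists a'^-1; rewrite exprVn a'K mulfV // addxx artin_schreier0.
exists (a^-1 + a'^-1); split; first by rewrite conjD !exprVn aK a'K.
  rewrite mulrDr mulfV // addrA addxx add0r.
  by have := artin_schreier_index2 divK'; rewrite (negPf h') orbF.
rewrite mulrDr mulfV // addrCA addxx addr0.
by have := artin_schreier_index2 divK; rewrite (negPf h) orbF.
Qed.

Lemma exists_fixed_sqrt z : z ^+ q = z -> exists2 s : F, s ^+ q = s & s ^+ 2 = z.
Proof.
move=> zK; have q_even : (q = q./2 * 2)%N.
  suff : ~~ odd q by lia.
  apply/negP => q_odd; have : q%:R = 1 :> F.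
    by rewrite -(odd_double_half q) q_odd -mul2n natrD natrM two0 mul0r addr0.
  by rewrite natr_q => /eqP; rewrite eq_sym oner_eq0.
exists (z ^+ q./2); first by rewrite exprAC zK.
by rewrite -exprM -q_even.
Qed.

Hypothesis b1 : b = 1.

(* The quadratic part of [f (x + d) - f x] is additive in [x] because the
   characteristic is 2; here [d = 1 / e] and [x = y / e]. *)
Lemma trinomial_collision e y : injective trinomial -> e != 0 ->
  y ^+ 2 + y ^+ q = 1 + e ^+ 2 + c * (e * e ^+ q) -> False.
Proof.
move=> f_inj e0 yE; have eq0 : e ^+ q != 0 by rewrite conj_eq0.
have : trinomial (y / e + e^-1) = trinomial (y / e).
  apply/eqP; rewrite -subr_eq0 !trinomialE b1 conjD exprMn exprVn; apply/eqP.
  transitivity ((2%:R * (y * (y ^+ q + 1)) + (y ^+ 2 + y ^+ q)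
     + (1 + e ^+ 2 + c * (e * e ^+ q))) / (e ^+ 2 * e ^+ q)).
    by move: (y ^+ q) (e ^+ q) eq0 => Y E E0; field; rewrite e0 E0.
  by rewrite yE two0 mul0r add0r addxx mul0r.
move/f_inj/eqP; rewrite -subr_eq0 addrAC subrr add0r invr_eq0.
by rewrite (negPf e0).
Qed.

(** With [e = r * w + s * w'] and [y = v * w + u * w'], the two hypotheses on [artin_schreier] are
    the [w'] and [w] coordinates of the collision equation; [r ^+ 2 + r * s + s ^+ 2] is the norm of
    [e]. *)
Lemma trinomial_coordinate_collision w w' a a' r s :
  w + w' = 1 -> w * w' = 1 -> w ^+ 2 = w' /\ w' ^+ 2 = w ->
  w ^+ q = w' /\ w' ^+ q = w -> c = a * w' + a' * w ->
  r ^+ q = r -> s ^+ q = s -> (r != 0) || (s != 0) ->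
  artin_schreier (1 + r ^+ 2 + a * (r ^+ 2 + r * s + s ^+ 2)) ->
  artin_schreier (1 + s ^+ 2 + a' * (r ^+ 2 + r * s + s ^+ 2)) ->
  injective trinomial -> False.
Proof.
move=> wD wM [w2 w'2] [wq w'q] cE rK sK rs0 /artin_schreierP[v vK vE] /artin_schreierP[u uK uE] f_inj.
pose e := r * w + s * w'; pose y := v * w + u * w'.
have eqE : e ^+ q = r * w' + s * w by rewrite conjD !exprMn rK sK wq w'q.
have yqE : y ^+ q = v * w' + u * w by rewrite conjD !exprMn vK uK wq w'q.
apply: (@trinomial_collision e y f_inj).
  apply: contraTneq rs0 => e0.
  have rs : r + s = 0.
    transitivity ((r + s) * (w + w')); first by rewrite wD mulr1.
    transitivity (e + e ^+ q); first by rewrite eqE /e; ring.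
    by rewrite e0 expr0n add0r; case: (q) q_gt1.
  have rE : r = s by rewrite -[r]addr0 -(addxx s) addrA rs add0r.
  by move: e0; rewrite /e rE -mulrDr wD mulr1 => ->; rewrite eqxx.
have eeq : e * e ^+ q = r ^+ 2 + r * s + s ^+ 2.
  rewrite eqE /e.
  transitivity ((r ^+ 2 + s ^+ 2) * (w * w') + r * s * (w ^+ 2 + w' ^+ 2)); first by ring.
  by rewrite w2 w'2 wM [w' + w]addrC wD; ring.
rewrite eeq yqE /e /y !sqrD !exprMn w2 w'2.
transitivity ((v ^+ 2 + v) * w' + (u ^+ 2 + u) * w); first by ring.
rewrite vE uE cE -[X in _ = X + _ + _]wD; ring.
Qed.

Lemma trinomial_pchar2_not_inj : injective trinomial -> False.
Proof.
move=> f_inj; have [w [w' [wD wM w2 wq]]] := exists_F4_generator.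
have [wqE w'qE] := wq.
pose t := c + c ^+ q; pose a := c + t * w; pose a' := c + t * w'.
have tK : t ^+ q = t by rewrite /t conjD conjK addrC.
have cqE : c ^+ q = c + t by rewrite /t addrA addxx add0r.
have aK : a ^+ q = a.
  by rewrite /a conjD exprMn tK wqE cqE -addrA -{1}[t]mulr1 -mulrDr -wD
     -addrA addxx addr0.
have a'K : a' ^+ q = a'.
  by rewrite /a' conjD exprMn tK w'qE cqE -addrA -{1}[t]mulr1 -mulrDr -wD
     addrAC addxx add0r.
have cE : c = a * w' + a' * w.
  transitivity (c * (w + w') + t * (w * w' + w * w')); last by rewrite /a /a'; ring.
  by rewrite wD addxx mulr1 mulr0 addr0.
have collision r s := @trinomial_coordinate_collision w w' a a' r s wD wM w2 wq cE.
have oneK (x : F) : x ^+ q = x -> (1 + x) ^+ q = 1 + x by move=> xK; rewrite conjD expr1n xK.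
have one_neq (x : F) : x != 1 -> 1 + x != 0.
  by apply: contraNneq => x1; rewrite -[x]add0r -(addxx 1) -addrA x1 addr0.
have scale (x y : F) : x ^+ q = x -> y ^+ q = y -> x != 0 -> y != 0 -> exists s,
    [/\ s ^+ q = s, s != 0, artin_schreier (1 + x * s ^+ 2) & artin_schreier (1 + y * s ^+ 2)].
  move=> xK yK x0 y0; have [z [zK h h']] := exists_scale_artin_schreier xK yK x0 y0.
  have [s sK sz] := exists_fixed_sqrt zK; exists s; rewrite sz; split=> //.
  apply: contraNneq artin_schreier1N => s0.
  by move: h; rewrite -sz s0 expr0n mulr0 addr0.
have zeroK : 0 ^+ q = 0 :> F by rewrite expr0n; case: (q) q_gt1.
(* The pairs [(0, s)], [(s, 0)], [(s, s)] all have norm [s ^+ 2] and leave only [a = a' = 1]. *)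
have [/andP[a0 a'1]|nA] := boolP ((a != 0) && (a' != 1)).
  have [s [sK s0 h h']] := scale _ _ aK (oneK _ a'K) a0 (one_neq _ a'1).
  apply: (collision 0 s) => //; first by rewrite s0 orbT.
    by rewrite (_ : _ + _ = 1 + a * s ^+ 2) //; ring.
  by rewrite (_ : _ + _ = 1 + (1 + a') * s ^+ 2) //; ring.
have [/andP[a'0 a1]|nB] := boolP ((a' != 0) && (a != 1)).
  have [s [sK s0 h h']] := scale _ _ a'K (oneK _ aK) a'0 (one_neq _ a1).
  apply: (collision s 0) => //; first by rewrite s0.
    by rewrite (_ : _ + _ = 1 + (1 + a) * s ^+ 2) //; ring.
  by rewrite (_ : _ + _ = 1 + a' * s ^+ 2) //; ring.
have [/andP[a1 a'1]|nC] := boolP ((a != 1) && (a' != 1)).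
  have [s [sK s0 h h']] := scale _ _ (oneK _ aK) (oneK _ a'K) (one_neq _ a1) (one_neq _ a'1).
  have NE : s ^+ 2 + s * s + s ^+ 2 = s ^+ 2 by rewrite -expr2 addxx add0r.
  apply: (collision s s) => //; rewrite ?s0 // NE.
    by rewrite (_ : _ + _ = 1 + (1 + a) * s ^+ 2) //; ring.
  by rewrite (_ : _ + _ = 1 + (1 + a') * s ^+ 2) //; ring.
have [a1 a'1] : a = 1 /\ a' = 1.
  have [a1|a1] := eqVneq a 1.
    by split=> //; apply/eqP; move: nA; rewrite a1 oner_neq0 /= negbK.
  move: nB nC; rewrite a1 andbT !negbK => /eqP -> /eqP/esym/eqP.
  by rewrite oner_eq0.
(* Here [2 < q] provides a fixed element outside [0] and [1]. *)
have [v vK v01] : exists2 v : F, v ^+ q = v & v * (v + 1) != 0.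
  pose Z : {set F} := [set 0; 1].
  have lt : (#|Z| < #|fixed_set|)%N by rewrite cards2 card_fixed_set; lia.
  have [v vK vn] : exists2 v, v \in fixed_set & v \notin Z.
    by apply/subsetPn; apply: contraTN lt => /subset_leq_card; rewrite leqNgt.
  move: vK vn; rewrite !inE negb_or => /eqP vK /andP[v0 v1]; exists v => //.
  by rewrite mulf_neq0 // addrC one_neq.
pose m := v ^+ 2 + v.
have mH : artin_schreier m by apply/artin_schreierP; exists v.
have mK : m ^+ q = m by rewrite conjD exprAC vK.
have m0 : m != 0 by move: v01; rewrite /m; congr (_ != _); ring.
(* For [(r, r + m)] the two constants reduce to [m ^+ 2] and [0]. *)
pose r := m^-1; have rm : r * m = 1 by rewrite mulVf.
have rK : r ^+ q = r by rewrite exprVn mK.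
have NE : r ^+ 2 + r * (r + m) + (r + m) ^+ 2 = r ^+ 2 + 1 + m ^+ 2.
  rewrite mulrDr rm sqrD; transitivity (r ^+ 2 + r ^+ 2 + (r ^+ 2 + 1 + m ^+ 2)).
    by ring.
  by rewrite addxx add0r.
apply: (collision r (r + m)) => //.
- by rewrite conjD rK mK.
- by rewrite invr_eq0 m0.
- rewrite NE a1 mul1r (_ : 1 + _ + _ = (1 + 1) + (r ^+ 2 + r ^+ 2) + m ^+ 2);
    last by ring.
  by rewrite !addxx !add0r artin_schreier_sqr.
- rewrite NE a'1 mul1r sqrD.
  rewrite (_ : 1 + _ + _ = (1 + 1) + (r ^+ 2 + r ^+ 2) + (m ^+ 2 + m ^+ 2));
    last by ring.
  by rewrite !addxx artin_schreier0.
Qed.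

End PcharTwo.

End QuadraticExtension.

(** * The field with four elements *)

Section QEqualsTwo.

Variables (F : finFieldType) (b c : F).
Hypotheses (cardF : #|F| = 4%N) (two0 : 2%:R = 0 :> F).

Lemma trinomial_q2E x : trinomial 2 b c x = (1 + c) * x + b * x ^+ 2.
Proof.
rewrite /trinomial; have -> : x ^+ (2 + 2) = x by rewrite -[RHS]expf_card cardF.
by ring.
Qed.

(** The map is additive, and [(1 + c) / b] lies in its kernel. *)
Lemma trinomial_q2_b_neq0 : b != 0 ->
  injective (trinomial 2 b c) <-> c = 1.
Proof.
move=> b0; split=> [f_inj|c1 x y].
  have : trinomial 2 b c ((1 + c) / b) = trinomial 2 b c 0.
    rewrite !trinomial_q2E.
    transitivity (2%:R * ((1 + c) ^+ 2 / b)); last by rewrite two0; ring.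
    by field.
  move/f_inj/eqP; rewrite mulf_eq0 invr_eq0 (negPf b0) orbF => /eqP c1.
  by rewrite -[c]add0r -two0 -[2%:R]/(1 + 1) -addrA c1 addr0.
rewrite !trinomial_q2E c1 -[1 + 1]/(2%:R) two0 !mul0r !add0r => /(mulfI b0)/eqP.
rewrite eqf_sqr => /orP[/eqP //|/eqP ->].
by apply/eqP; rewrite -subr_eq0 -opprD oppr_eq0 -mulr2n -mulr_natr two0 mulr0.
Qed.

Lemma trinomial_q2_b_eq0 : b = 0 -> injective (trinomial 2 b c) ->
  c ^+ 2 + (c ^+ 2) ^+ 2 = c * c ^+ 2.
Proof.
move=> b0 f_inj.
have c1 : c + 1 != 0.
  apply: contraNneq (oner_neq0 F) => c1; apply/eqP/f_inj.
  by rewrite !trinomial_q2E b0 [1 + c]addrC c1; ring.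
have c4 : c ^+ 4 = c by rewrite -[RHS]expf_card cardF.
have /eqP : c * ((c + 1) * (c ^+ 2 + c + 1)) = 0.
  transitivity (c ^+ 4 + c + 2%:R * (c ^+ 3 + c ^+ 2)); first by ring.
  rewrite c4 two0 mul0r addr0.
  by transitivity (2%:R * c); [ring | rewrite two0 mul0r].
rewrite !mulf_eq0 (negPf c1) /= => /orP[/eqP ->|/eqP c0]; first by ring.
apply/eqP; rewrite -subr_eq0; apply/eqP.
transitivity (c ^+ 2 * (c ^+ 2 + c + 1) - 2%:R * c ^+ 3); first by ring.
by rewrite c0 two0; ring.
Qed.

End QEqualsTwo.

(** * Reduction to [b = 1] and assembly of the cases *)

Lemma trinomial_scale (F : finFieldType) q (b c a : F) : a != 0 -> a ^+ 2 = b ->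
  injective (trinomial q b c) ->
  injective (trinomial q 1 (c / (a * a ^+ q))).
Proof.
move=> a0 ab f_inj.
have aq0 : a ^+ q != 0 by rewrite expf_neq0.
have scaleE x : trinomial q b c (a * x) =
    a ^+ 2 * a ^+ q * trinomial q 1 (c / (a * a ^+ q)) x.
  rewrite !trinomialE -ab [(a * x) ^+ q]exprMn.
  by move: (a ^+ q) (x ^+ q) aq0 => A X A0; field; rewrite a0 A0.
by move=> x y xy; apply: (mulfI a0); apply: f_inj; rewrite !scaleE xy.
Qed.

Theorem theorem1p3 (q : nat) (hq : prime_power q)
  (F : finFieldType) (hF : #|F| = (q ^ 2)%N) (b c : F) :
  bijective (fun x : F => x ^+ (q + 2) + b * x ^+ q + c * x) <->
  ( (q %% 3 != 1)%N /\ b = 0 /\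
      root ('X^3 - 'X^2 + 'X : {poly F}) (c ^+ (q - 1)) )
  \/ ( q = 2%N /\ b != 0 /\ c = 1 ).
Proof.
case: hq => p [k [p_pr [k0 qE]]].
have q_gt1 : (1 < q)%N by rewrite qE -(expn0 p) ltn_exp2l // prime_gt1.
have pF : p \in [pchar F].
  by apply: (@card_finPcharP _ _ (k * 2)) => //; rewrite hF qE expnM.
have q_pchar : [pchar F].-nat q by rewrite qE pnatX pnatE // pF.
have pchar_eq r : r \in [pchar F] -> p = r.
  by rewrite (pcharf_eq pF) inE => /eqP ->.
have two_pchar : 2%:R = 0 :> F -> p = 2%N.
  by move=> two0; apply: pchar_eq; rewrite inE two0 eqxx.
rewrite root_cubicP //; split=> [/bij_inj f_inj|H]; last first.
  apply: injF_bij; case: H => [[q1 [b0 cE]]|[q2 [b0 c1]]].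
    exact: (@trinomial_inj F q q_gt1 q_pchar hF b c b0 q1 cE).
  have two0 : 2%:R = 0 :> F by rewrite -q2; apply: natr_q.
  rewrite q2 in hF *.
  by apply/(@trinomial_q2_b_neq0 F b c hF two0 b0).
rewrite -/(trinomial q b c) in f_inj.
have q1 := trinomial_mod3_neq1 q_gt1 q_pchar hF f_inj.
have [q2|q2] := eqVneq q 2%N.
  have two0 : 2%:R = 0 :> F by rewrite -q2; apply: natr_q.
  rewrite q2 in hF f_inj q1 *; have [b0|b0] := eqVneq b 0.
    by left; split=> //; split=> //; apply: trinomial_q2_b_eq0 f_inj.
  by right; split=> //; split=> //; apply/(@trinomial_q2_b_neq0 F b c hF two0 b0).
left; split=> //; have [q3|q3] := boolP (3 %| q)%N.
  have F3 : 3%N \in [pchar F] by apply: pchar_dvd_q q3.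
  have p3 := pchar_eq _ F3.
  pose r := (3 ^ k.-1)%N.
  have qr : q = (3 * r)%N by rewrite qE p3 -expnS prednK.
  have b0 : b = 0.
    apply: (@trinomial_mod3_eq0 F q q_gt1 q_pchar hF b c r) => //.
      by rewrite expn_gt0.
    (* Either [r = 1] and [r + 1 = 2], or [3] divides [r]. *)
    rewrite -(dvdn_pcharf F3) /r; case: (k.-1) => // n.
    by rewrite expnS dvdn_addr // dvdn_mulr.
  split=> //; have three0 := pcharf0 F3.
  have /eqP := @trinomial_pchar3_trace F q q_gt1 q_pchar hF b c b0 f_inj three0.
  rewrite addrC addr_eq0 => /eqP ->; apply/eqP; rewrite -subr_eq0; apply/eqP.
  by transitivity (3%:R * c ^+ 2); [ring | rewrite three0 mul0r].
have [s qs] : exists s, q.+1 = (3 * s)%N by exists (q.+1 %/ 3)%N; lia.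
have s1 : (1 < s)%N by lia.
have [q_odd|q_even] := boolP (odd q).
  have two0 : 2%:R != 0 :> F.
    by apply: contraTneq q_odd => /two_pchar p2; rewrite qE p2 oddX negb_or /=; lia.
  have b0 := @trinomial_mod3_eq2_odd F q q_gt1 q_pchar hF b c s f_inj s1 qs q_odd two0.
  split=> //.
  have := @trinomial_norm_relation F q q_gt1 q_pchar hF b c s f_inj s1 qs (or_introl q_odd).
  by rewrite b0 mul0r addr0.
have F2 : 2%N \in [pchar F] by apply: (@pchar_dvd_q F q) => //; lia.
have two0 := pcharf0 F2.
have q4 : (4 %| q)%N.
  move: q2 k0; rewrite qE (two_pchar two0); case: k {qE} => [|[|k]] // _ _.
  by rewrite !expnS mulnA dvdn_mulr.
have b0 : b = 0.
  apply/eqP/negPn/negP => b_neq0.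
  (* A square root of [b], since [b ^+ (q * q) = b]. *)
  pose a := b ^+ (q * q./2).
  have ab : a ^+ 2 = b.
    rewrite -exprM -mulnA (_ : q./2 * 2 = q)%N; last lia.
    by rewrite mulnn -hF expf_card.
  have a0 : a != 0 by rewrite expf_neq0.
  apply: (@trinomial_pchar2_not_inj F q q_gt1 q_pchar hF 1 (c / (a * a ^+ q))) => //.
  - by lia.
  - by lia.
  exact: trinomial_scale ab f_inj.
split=> //.
have := @trinomial_norm_relation F q q_gt1 q_pchar hF b c s f_inj s1 qs
  (or_intror (conj two0 q4)).
by rewrite b0 mul0r addr0.
Qed.
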